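(* Let $$|\psi\rangle_7=\alpha_1|0000000\rangle+\alpha_2|0001111\rangle+\alpha_3|1111000\rangle+\alpha_4|1110111\rangle,\qquad \alpha_1^2+\alpha_2^2+\alpha_3^2+\alpha_4^2=1,$$ with the coefficients written as $$\alpha_1=\sin\theta_1,\quad \alpha_2=\cos\theta_1\sin\theta_2,\quad \alpha_3=\cos\theta_1\cos\theta_2\cos\theta_3,\quad \alpha_4=\cos\theta_1\cos\theta_2\sin\theta_3,$$ where $0\le\theta_1\le2\pi$ and $0\le\theta_2,\theta_3\le\pi$. Then $\alpha_1^2,\alpha_2^2,\alpha_3^2,\alpha_4^2$ can be expressed in terms of the concurrences $C_{1,A}(\psi)$, $C_{2,A}(\psi)$, $C_A(\psi)$: one solution (not the most generic one) for the angles in terms of the concurrences is $$\sin^2\theta_1=\frac12-\frac{\sqrt{1-C_{1,A}^2(\psi)}}{2},\qquad \cos^2\theta_2=\frac{\sqrt{1-C_{1,A}^2(\psi)}+\sqrt{1-C_{2,A}^2(\psi)}}{1+\sqrt{1-C_{1,A}^2(\psi)}},$$ $$\cos^2\theta_3=\frac{\dfrac{\sqrt{1-C_{1,A}^2(\psi)}\sqrt{1-C_{2,A}^2(\psi)}+1-C_{1,A}^2(\psi)}{\sqrt{1-C_{1,A}^2(\psi)}+\sqrt{1-C_{2,A}^2(\psi)}}+\sqrt{1-C_A^2(\psi)}}{\sqrt{1-C_{1,A}^2(\psi)}+\sqrt{1-C_{2,A}^2(\psi)}} .$$ In this way the quantum states can be classified by $C_{1,A}^2(\psi)$ (determined by $\beta_1^2$),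 $C_{2,A}^2(\psi)$ (determined by $\gamma_1^2$ and $\gamma_2^2$) and $C_A^2(\psi)$ (determined by $\alpha_1^2,\alpha_2^2,\alpha_3^2$), where $\beta_1=\gamma_1=\sin\theta_1$ and $\gamma_2=\cos\theta_1\sin\theta_2$.
   Context: Seven qubits: region $A$ is the last (seventh) qubit and region $B$ is the first six qubits. For a pure state $\psi$ with $\rho=|\psi\rangle\langle\psi|$ and $\rho_A=\mathrm{Tr}_B\,\rho$, the concurrence is $C_A(\psi)=\sqrt{2(1-\mathrm{Tr}_A\rho_A^2)}$; here $\mathrm{Tr}_A\rho_A^2=(\alpha_1^2+\alpha_3^2)^2+(\alpha_2^2+\alpha_4^2)^2$. $C_{1,A}(\psi)=\sqrt{2(1-\mathrm{Tr}_A\rho_{1,A}^2)}$ is the concurrence of the state of the same form obtained by setting $\theta_2=\pi/2$ and $\theta_3=0$, i.e. with coefficients $(\beta_1,\beta_2,\beta_3,\beta_4)=(\sin\theta_1,\cos\theta_1,0,0)$, for which $\mathrm{Tr}_A\rho_{1,A}^2=\beta_1^4+\beta_2^4$. $C_{2,A}(\psi)=\sqrt{2(1-\mathrm{Tr}_A\rho_{2,A}^2)}$ is the concurrence of the state of the same form obtained by setting $\theta_3=0$ (keeping $\theta_1,\theta_2$), i.e. with coefficients $(\gamma_1,\gamma_2,\gamma_3,\gamma_4)=(\sin\theta_1,\cos\theta_1\sin\theta_2,\cos\theta_1\cos\theta_2,0)$, for which $\mathrm{Tr}_A\rho_{2,A}^2=(\gamma_1^2+\gamma_3^2)^2+\g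amma_2^4$.
   Formalization: The formulas and classification hold for a state's own angles only if α1²≤1/2 and α2²+α4²≤α1²+α3²; angles solving the formulas exist only if C_{2,A}≤C_A (cos²θ3=2 at θ=(0,π/4,π/2)); the third formula is not imposed when its denominator is 0. *)

(* Defs.v *)
(* MathComp / MathComp-Analysis: the reals are an arbitrary [R : realType],
   amplitudes live in [R[i]]. *)
From HB Require Import structures.
From mathcomp Require Import all_boot all_order all_algebra.
From mathcomp Require Import reals trigo.
From mathcomp Require Import complex.

Set Implicit Arguments.
Unset Strict Implicit.
Unset Printing Implicit Defensive.

Import Order.TTheory GRing.Theory Num.Theory.
Local Open Scope ring_scope.
Local Open Scope complex_scope.

(* A vector of (C^2)^{\otimes n}, given by its amplitudes in the computational
   basis, which is indexed by the bit strings of length n. *)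
Definition qstate (R : realType) (n : nat) := {ffun n.-tuple 'I_2 -> R[i]}.

Definition ket (R : realType) (n : nat) (x : n.-tuple 'I_2) : qstate R n :=
  [ffun y => (y == x)%:R].

(* Entries <x| rho |y> of rho = |psi><psi|. *)
Definition density (R : realType) (n : nat) (psi : qstate R n)
    (x y : n.-tuple 'I_2) : R[i] :=
  psi x * conjc (psi y).

(* rho_A = Tr_B rho, where A is the last qubit and B consists of the n others. *)
Definition reduced_last (R : realType) (n : nat)
    (rho : n.+1.-tuple 'I_2 -> n.+1.-tuple 'I_2 -> R[i]) : 'M[R[i]]_2 :=
  \matrix_(a < 2, a' < 2)
    \sum_(b : n.-tuple 'I_2) rho [tuple of rcons b a] [tuple of rcons b a'].

(* Tr rho_A^2 is real since rho_A is Hermitian, so taking its real part loses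
   nothing. *)
Definition purity_last (R : realType) (n : nat) (psi : qstate R n.+1) : R :=
  complex.Re (\tr (reduced_last (density psi) *m reduced_last (density psi))).

Definition concurrence_last (R : realType) (n : nat) (psi : qstate R n.+1) : R :=
  Num.sqrt (2 * (1 - purity_last psi)).

Definition psi7 (R : realType) (a1 a2 a3 a4 : R) : qstate R 7 :=
    a1%:C *: ket R [tuple 0; 0; 0; 0; 0; 0; 0]
  + a2%:C *: ket R [tuple 0; 0; 0; 1; 1; 1; 1]
  + a3%:C *: ket R [tuple 1; 1; 1; 1; 0; 0; 0]
  + a4%:C *: ket R [tuple 1; 1; 1; 0; 1; 1; 1].

Definition angle_range (R : realType) (t1 t2 t3 : R) : Prop :=
  [/\ 0 <= t1 <= 2 * pi, 0 <= t2 <= pi & 0 <= t3 <= pi].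

Definition alpha1 (R : realType) (t1 t2 t3 : R) : R := sin t1.
Definition alpha2 (R : realType) (t1 t2 t3 : R) : R := cos t1 * sin t2.
Definition alpha3 (R : realType) (t1 t2 t3 : R) : R := cos t1 * cos t2 * cos t3.
Definition alpha4 (R : realType) (t1 t2 t3 : R) : R := cos t1 * cos t2 * sin t3.

Definition angle_state (R : realType) (t1 t2 t3 : R) : qstate R 7 :=
  psi7 (alpha1 t1 t2 t3) (alpha2 t1 t2 t3) (alpha3 t1 t2 t3) (alpha4 t1 t2 t3).

Definition conc (R : realType) (t1 t2 t3 : R) : R :=
  concurrence_last (angle_state t1 t2 t3).
Definition conc1 (R : realType) (t1 : R) : R := conc t1 (pi / 2) 0.
Definition conc2 (R : realType) (t1 t2 : R) : R := conc t1 t2 0.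

(* sqrt (1 - C^2), the building block of the solution. *)
Definition co (R : realType) (c : R) : R := Num.sqrt (1 - c ^+ 2).

Definition sol_sin2_1 (R : realType) (c1 : R) : R := 1 / 2 - co c1 / 2.
Definition sol_cos2_2 (R : realType) (c1 c2 : R) : R :=
  (co c1 + co c2) / (1 + co c1).
Definition sol_cos2_3 (R : realType) (c1 c2 c : R) : R :=
  ((co c1 * co c2 + 1 - c1 ^+ 2) / (co c1 + co c2) + co c) / (co c1 + co c2).

(* The angles are given by the solution formulas at the concurrence values
   c1, c2, c.  The denominator of the third formula vanishes exactly when
   cos^2 t2 is prescribed to be 0; then alpha3 = alpha4 = 0, the angle t3 plays
   no role, and the formula imposes nothing on it. *)
Definition angle_solution (R : realType) (c1 c2 c t1 t2 t3 : R) : Prop :=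
  [/\ sin t1 ^+ 2 = sol_sin2_1 c1,
      cos t2 ^+ 2 = sol_cos2_2 c1 c2
    & co c1 + co c2 != 0 -> cos t3 ^+ 2 = sol_cos2_3 c1 c2 c].

(* The choice of signs behind the solution: for all angles,
   co (conc1 t1) = |1 - 2 alpha1^2| and
   co (conc t1 t2 t3) = |(alpha1^2 + alpha3^2) - (alpha2^2 + alpha4^2)|, and the
   solution drops these absolute values.  That of
   co (conc2 t1 t2) = |1 - 2 alpha2^2| can then be dropped too. *)
Definition sign_choice (R : realType) (t1 t2 t3 : R) : Prop :=
  alpha1 t1 t2 t3 ^+ 2 <= 1 / 2 /\
  alpha2 t1 t2 t3 ^+ 2 + alpha4 t1 t2 t3 ^+ 2
    <= alpha1 t1 t2 t3 ^+ 2 + alpha3 t1 t2 t3 ^+ 2.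

(* Main.v *)
(* The four basis vectors of psi restrict to pairwise distinct vectors of B, so
   rho_A is diagonal with eigenvalues p = alpha1^2 + alpha3^2 and
   q = alpha2^2 + alpha4^2.  Since p + q = 1, C_A^2 = 4 p q = 1 - (p - q)^2, that
   is, sqrt (1 - C_A^2) = |p - q|.  Write m1, m2, m3 for the values of p - q for
   the three states defining C_1A, C_2A, C_A at angles s1, s2, s3, and u, v, w for
   the values of sqrt (1 - C^2) of the three given concurrences.  Then
     m1 = 2 sin^2 s1 - 1,  m2 = 1 - 2 cos^2 s1 (1 - cos^2 s2),
     m3 = 1 - 2 cos^2 s1 (1 - cos^2 s2 cos^2 s3),
   and the three solution formulas are equivalent to m1 = - u, m2 = v, m3 = w;
   the third one simplifies to cos^2 s3 = (u + w) / (u + v). *)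
Require Import Defs.
From HB Require Import structures.
From mathcomp Require Import all_boot all_order all_algebra.
From mathcomp Require Import reals trigo.
From mathcomp Require Import complex.
From mathcomp Require Import ring lra.

Set Implicit Arguments.
Unset Strict Implicit.
Unset Printing Implicit Defensive.

Import Order.TTheory GRing.Theory Num.Theory.
Local Open Scope ring_scope.
Local Open Scope complex_scope.

(** * Reduced density matrix and purity of a four-term superposition *)

Lemma ket_comb4E (R : realType) n (x1 x2 x3 x4 x : n.-tuple 'I_2) (a1 a2 a3 a4 : R) :
  (a1%:C *: ket R x1 + a2%:C *: ket R x2 + a3%:C *: ket R x3
     + a4%:C *: ket R x4) x =
  (a1 * (x == x1)%:R + a2 * (x == x2)%:R + a3 * (x == x3)%:R
     + a4 * (x == x4)%:R)%:C.
Proof. by rewrite !ffunE !rmorphD !rmorphM /= !rmorph_nat. Qed.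

Lemma eq_rcons_tuple n (T : eqType) (b c : n.-tuple T) (e f : T) (x : n.+1.-tuple T) :
  x = rcons c f :> seq T -> ([tuple of rcons b e] == x) = (b == c) && (e == f).
Proof. by move=> xE; rewrite -val_eqE /= xE eqseq_rcons. Qed.

(** Since the [yi] are distinct, each [b] meets at most one ket, so no cross term survives the
    partial trace. The [xi] are constrained as sequences so that concrete tuples satisfy the
    equations by computation. *)
Lemma reduced_comb4 (R : realType) n (y1 y2 y3 y4 : n.-tuple 'I_2)
    (x1 x2 x3 x4 : n.+1.-tuple 'I_2) (a1 a2 a3 a4 : R) (e f : 'I_2) :
  uniq [:: y1; y2; y3; y4] ->
  x1 = rcons y1 0 :> seq _ -> x2 = rcons y2 1 :> seq _ ->
  x3 = rcons y3 0 :> seq _ -> x4 = rcons y4 1 :> seq _ ->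
  reduced_last (density (a1%:C *: ket R x1 + a2%:C *: ket R x2
                         + a3%:C *: ket R x3 + a4%:C *: ket R x4)) e f =
    (((e == 0) && (f == 0))%:R * (a1 ^+ 2 + a3 ^+ 2)
     + ((e == 1) && (f == 1))%:R * (a2 ^+ 2 + a4 ^+ 2))%:C.
Proof.
rewrite /= !inE !negb_or -!andbA => /and5P[n12 n13 n14 n23 /and3P[n24 n34 _]].
move=> e1 e2 e3 e4; rewrite mxE.
transitivity (\sum_(b : n.-tuple 'I_2)
   ((b == y1)%:R * (((e == 0) && (f == 0))%:R * a1 ^+ 2)
   + (b == y2)%:R * (((e == 1) && (f == 1))%:R * a2 ^+ 2)
   + (b == y3)%:R * (((e == 0) && (f == 0))%:R * a3 ^+ 2)
   + (b == y4)%:R * (((e == 1) && (f == 1))%:R * a4 ^+ 2))%:C).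
  apply: eq_bigr => b _; rewrite /density !ket_comb4E.
  rewrite !(eq_rcons_tuple _ _ e1) !(eq_rcons_tuple _ _ e2).
  rewrite !(eq_rcons_tuple _ _ e3) !(eq_rcons_tuple _ _ e4).
  rewrite conjc_real -rmorphM; congr (_%:C).
  case: (eqVneq b y1) => [->|_].
    rewrite (negbTE n12) (negbTE n13) (negbTE n14).
    by case: (e == 0); case: (f == 0) => /=; ring.
  case: (eqVneq b y2) => [->|_].
    rewrite (negbTE n23) (negbTE n24).
    by case: (e == 1); case: (f == 1) => /=; ring.
  case: (eqVneq b y3) => [->|_].
    rewrite (negbTE n34).
    by case: (e == 0); case: (f == 0) => /=; ring.
  case: (eqVneq b y4) => [_|_].
    by case: (e == 1); case: (f == 1) => /=; ring.
  by rewrite /=; ring.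
rewrite -rmorph_sum; congr (_%:C) => /=.
have S (y : n.-tuple 'I_2) : \sum_(b : n.-tuple 'I_2) (b == y)%:R = 1 :> R.
  by rewrite (bigD1 y) //= eqxx big1 ?addr0 // => b /negbTE ->.
by rewrite !big_split /= -!mulr_suml !S; ring.
Qed.

Lemma purity_comb4 (R : realType) n (y1 y2 y3 y4 : n.-tuple 'I_2)
    (x1 x2 x3 x4 : n.+1.-tuple 'I_2) (a1 a2 a3 a4 : R) :
  uniq [:: y1; y2; y3; y4] ->
  x1 = rcons y1 0 :> seq _ -> x2 = rcons y2 1 :> seq _ ->
  x3 = rcons y3 0 :> seq _ -> x4 = rcons y4 1 :> seq _ ->
  purity_last (a1%:C *: ket R x1 + a2%:C *: ket R x2
               + a3%:C *: ket R x3 + a4%:C *: ket R x4) =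
    (a1 ^+ 2 + a3 ^+ 2) ^+ 2 + (a2 ^+ 2 + a4 ^+ 2) ^+ 2.
Proof.
move=> Uy e1 e2 e3 e4; rewrite /purity_last /mxtrace.
rewrite big_ord_recl big_ord1 !mxE !big_ord_recl !big_ord0.
rewrite !(reduced_comb4 _ _ _ _ _ _ Uy e1 e2 e3 e4) -!rmorphM -!rmorphD /=.
ring.
Qed.

Lemma psi7_purity (R : realType) (a1 a2 a3 a4 : R) :
  purity_last (psi7 a1 a2 a3 a4) =
    (a1 ^+ 2 + a3 ^+ 2) ^+ 2 + (a2 ^+ 2 + a4 ^+ 2) ^+ 2.
Proof.
rewrite /psi7.
by refine (@purity_comb4 R 6 [tuple 0; 0; 0; 0; 0; 0] [tuple 0; 0; 0; 1; 1; 1]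
  [tuple 1; 1; 1; 1; 0; 0] [tuple 1; 1; 1; 0; 1; 1] _ _ _ _ a1 a2 a3 a4 _ _ _ _ _).
Qed.

(** * Squared amplitudes and eigenvalue difference in terms of the angles *)

Lemma alpha1_sqr (R : realType) (t1 t2 t3 : R) :
  alpha1 t1 t2 t3 ^+ 2 = sin t1 ^+ 2.
Proof. by []. Qed.

Lemma alpha2_sqr (R : realType) (t1 t2 t3 : R) :
  alpha2 t1 t2 t3 ^+ 2 = (1 - sin t1 ^+ 2) * (1 - cos t2 ^+ 2).
Proof. by rewrite /alpha2 exprMn (cos2sin2 t1) (sin2cos2 t2). Qed.

Lemma alpha3_sqr (R : realType) (t1 t2 t3 : R) :
  alpha3 t1 t2 t3 ^+ 2 = (1 - sin t1 ^+ 2) * cos t2 ^+ 2 * cos t3 ^+ 2.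
Proof. by rewrite /alpha3 !exprMn (cos2sin2 t1). Qed.

Lemma alpha4_sqr (R : realType) (t1 t2 t3 : R) :
  alpha4 t1 t2 t3 ^+ 2 = (1 - sin t1 ^+ 2) * cos t2 ^+ 2 * (1 - cos t3 ^+ 2).
Proof. by rewrite /alpha4 !exprMn (cos2sin2 t1) (sin2cos2 t3). Qed.

Definition alpha_sqr := (alpha1_sqr, alpha2_sqr, alpha3_sqr, alpha4_sqr).

Lemma alpha_norm (R : realType) (t1 t2 t3 : R) :
  alpha1 t1 t2 t3 ^+ 2 + alpha2 t1 t2 t3 ^+ 2
    + alpha3 t1 t2 t3 ^+ 2 + alpha4 t1 t2 t3 ^+ 2 = 1.
Proof. by rewrite !alpha_sqr; ring. Qed.

(* The difference of the two eigenvalues of rho_A. *)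
Definition imbalance (R : realType) (t1 t2 t3 : R) : R :=
  alpha1 t1 t2 t3 ^+ 2 + alpha3 t1 t2 t3 ^+ 2
  - (alpha2 t1 t2 t3 ^+ 2 + alpha4 t1 t2 t3 ^+ 2).

Lemma imbalanceE (R : realType) (t1 t2 t3 : R) :
  imbalance t1 t2 t3 =
    1 - 2 * (1 - sin t1 ^+ 2) * (1 - cos t2 ^+ 2 * cos t3 ^+ 2).
Proof. by rewrite /imbalance !alpha_sqr; ring. Qed.

Lemma imbalance1E (R : realType) (t1 : R) :
  imbalance t1 (pi / 2) 0 = 2 * sin t1 ^+ 2 - 1.
Proof. by rewrite imbalanceE cos_pihalf; ring. Qed.

Lemma imbalance2E (R : realType) (t1 t2 : R) :
  imbalance t1 t2 0 = 1 - 2 * (1 - sin t1 ^+ 2) * (1 - cos t2 ^+ 2).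
Proof. by rewrite imbalanceE cos0; ring. Qed.

Lemma imbalance_sqr_le1 (R : realType) (t1 t2 t3 : R) :
  imbalance t1 t2 t3 ^+ 2 <= 1.
Proof.
have := alpha_norm t1 t2 t3; rewrite /imbalance.
have := sqr_ge0 (alpha1 t1 t2 t3); have := sqr_ge0 (alpha2 t1 t2 t3).
have := sqr_ge0 (alpha3 t1 t2 t3); have := sqr_ge0 (alpha4 t1 t2 t3).
by move=> ? ? ? ? ?; rewrite -real_normK ?num_real // expr_le1 // ler_norml; lra.
Qed.

(** Replacing [t3] by 0 moves the weight [alpha4 ^+ 2] from q to p, which raises p - q by twice that
    weight. *)
Lemma imbalance_le2 (R : realType) (t1 t2 t3 : R) :
  imbalance t1 t2 t3 <= imbalance t1 t2 0.
Proof.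
have := alpha_norm t1 t2 t3.
have := sqr_ge0 (alpha4 t1 t2 t3).
rewrite imbalance2E -mulrA -(alpha2_sqr _ _ t3) /imbalance; lra.
Qed.

(** * Concurrence as a function of the eigenvalue difference *)

Lemma conc_imbalance (R : realType) (t1 t2 t3 : R) :
  conc t1 t2 t3 = Num.sqrt (1 - imbalance t1 t2 t3 ^+ 2).
Proof.
rewrite /conc /concurrence_last /angle_state psi7_purity; congr Num.sqrt.
have h := alpha_norm t1 t2 t3; rewrite /imbalance.
have -> : alpha2 t1 t2 t3 ^+ 2 + alpha4 t1 t2 t3 ^+ 2
        = 1 - (alpha1 t1 t2 t3 ^+ 2 + alpha3 t1 t2 t3 ^+ 2) by rewrite -h; ring.
by ring.
Qed.

Lemma conc_sqr (R : realType) (t1 t2 t3 : R) :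
  conc t1 t2 t3 ^+ 2 = 1 - imbalance t1 t2 t3 ^+ 2.
Proof. by rewrite conc_imbalance sqr_sqrtr // subr_ge0 imbalance_sqr_le1. Qed.

Lemma co_conc (R : realType) (t1 t2 t3 : R) :
  co (conc t1 t2 t3) = `|imbalance t1 t2 t3|.
Proof. by rewrite /co conc_sqr subKr sqrtr_sqr. Qed.

Lemma conc_ge0 (R : realType) (t1 t2 t3 : R) : 0 <= conc t1 t2 t3.
Proof. by rewrite conc_imbalance sqrtr_ge0. Qed.

Lemma conc_sqr_le1 (R : realType) (t1 t2 t3 : R) : conc t1 t2 t3 ^+ 2 <= 1.
Proof. by rewrite conc_sqr gerBl sqr_ge0. Qed.

Lemma conc_le (R : realType) (t1 t2 t3 s1 s2 s3 : R) :
  `|imbalance s1 s2 s3| <= `|imbalance t1 t2 t3| -> conc t1 t2 t3 <= conc s1 s2 s3.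
Proof.
rewrite !conc_imbalance; move: (imbalance t1 t2 t3) (imbalance s1 s2 s3) => x y xy.
apply: ler_wsqrtr; rewrite lerD2l lerN2.
rewrite -(@real_normK _ x) ?num_real // -(@real_normK _ y) ?num_real //.
by rewrite ler_sqr ?nnegrE.
Qed.

Lemma eq_conc (R : realType) (t1 t2 t3 s1 s2 s3 : R) :
  `|imbalance s1 s2 s3| = `|imbalance t1 t2 t3| -> conc s1 s2 s3 = conc t1 t2 t3.
Proof.
rewrite !conc_imbalance; move: (imbalance s1 s2 s3) (imbalance t1 t2 t3).
by move=> x y xy; rewrite -(@real_normK _ x) ?num_real // xy real_normK ?num_real.
Qed.

Lemma co_ge0 (R : realType) (c : R) : 0 <= co c.
Proof. exact: sqrtr_ge0. Qed.

Lemma co_le1 (R : realType) (c : R) : co c <= 1.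
Proof. by rewrite /co -[leRHS]sqrtr1 ler_wsqrtr // gerBl sqr_ge0. Qed.

Lemma co_le (R : realType) (c c' : R) : 0 <= c -> c <= c' -> co c' <= co c.
Proof.
move=> c0 cc'; apply: ler_wsqrtr; rewrite lerD2l lerN2.
by rewrite ler_sqr ?nnegrE // (le_trans c0).
Qed.

Lemma co_sqr (R : realType) (c : R) : c ^+ 2 <= 1 -> co c ^+ 2 = 1 - c ^+ 2.
Proof. by move=> c1; rewrite sqr_sqrtr ?subr_ge0. Qed.

(* If C_1A = C_2A = 1 then alpha1^2 = alpha2^2 = 1/2, so alpha3 = alpha4 = 0. *)
Lemma imbalance_eq0 (R : realType) (t1 t2 t3 : R) :
  `|imbalance t1 (pi / 2) 0| + `|imbalance t1 t2 0| = 0 ->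
  `|imbalance t1 t2 t3| = 0.
Proof.
have core (m1 m2 m3 x y z : R) : m1 = 2 * x - 1 -> m2 = 1 - 2 * (1 - x) * (1 - y) ->
    m3 = 1 - 2 * (1 - x) * (1 - y * z) -> `|m1| + `|m2| = 0 -> `|m3| = 0.
  move=> e1 e2 e3 e12; have h1 := normr_ge0 m1; have h2 := normr_ge0 m2.
  have /normr0_eq0 m10 : `|m1| = 0 by lra.
  have /normr0_eq0 m20 : `|m2| = 0 by lra.
  have x2 : x = 1 / 2 by lra.
  have y0 : y = 0 by move: e2; rewrite x2; lra.
  by apply/normr0P/eqP; rewrite e3 x2 y0; lra.
exact: core (imbalance1E t1) (imbalance2E t1 t2) (imbalanceE t1 t2 t3).
Qed.

(** * Solution formulas as equations between eigenvalue differences *)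

(** The hypothesis [u + v = 0 -> w = 0] supplies the third equation in the degenerate case, where
    [angle_solution] leaves [s3] free. *)
Lemma angle_solution_imbalance (R : realType) (c1 c2 c u v w s1 s2 s3 : R) :
  c1 ^+ 2 <= 1 -> co c1 = u -> co c2 = v -> co c = w ->
  (u + v = 0 -> w = 0) ->
  angle_solution c1 c2 c s1 s2 s3 <->
  [/\ imbalance s1 (pi / 2) 0 = - u, imbalance s1 s2 0 = v
    & imbalance s1 s2 s3 = w].
Proof.
move=> c1_le1 eu ev ew w0; have := co_sqr c1_le1.
have := co_ge0 c1; have := co_ge0 c2.
rewrite /angle_solution /sol_sin2_1 /sol_cos2_2 /sol_cos2_3 {}eu {}ev {}ew.
rewrite imbalance1E imbalance2E imbalanceE => v_ge0 u_ge0 u2.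
(* Here [1 - c1 ^+ 2 = u ^+ 2], so the inner fraction of the third formula reduces to [u]. *)
have -> : u * v + 1 - c1 ^+ 2 = u * (u + v) by rewrite -addrA -u2; ring.
move: (sin s1 ^+ 2) (cos s2 ^+ 2) (cos s3 ^+ 2) => X Y Z.
have u1 : 1 + u != 0 by lra.
split=> [[eX eY eZ]|[eX eY eZ]].
  have eY' : (1 + u) * Y = u + v by rewrite eY mulrC divfK.
  have eX' : 2 * (1 - X) = 1 + u by rewrite eX; lra.
  rewrite eX'; split; [lra | by rewrite mulrBr eY'; lra |].
  have -> : 1 - (1 + u) * (1 - Y * Z) = (1 + u) * Y * Z - u by ring.
  (* If [u + v = 0], nonnegativity forces [u = 0], and both sides vanish. *)
  rewrite eY'; have [uv0|uv] := eqVneq (u + v) 0.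
    by rewrite uv0; have := w0 uv0; lra.
  by rewrite eZ //; field.
have eX' : 2 * (1 - X) = 1 + u by lra.
have eY' : (1 + u) * Y = u + v by rewrite -eY eX'; ring.
have eZ' : (u + v) * Z = u + w by rewrite -eZ -eY' eX'; ring.
split=> [||uv]; first lra.
  by rewrite -eY' mulrC mulKf.
have -> : Z = (u + w) / (u + v) by rewrite -eZ' mulrC mulKf.
by field.
Qed.

Lemma conc_angle_solution (R : realType) (t1 t2 t3 s1 s2 s3 : R) :
  angle_solution (conc1 t1) (conc2 t1 t2) (conc t1 t2 t3) s1 s2 s3 <->
  [/\ imbalance s1 (pi / 2) 0 = - `|imbalance t1 (pi / 2) 0|,
      imbalance s1 s2 0 = `|imbalance t1 t2 0|
    & imbalance s1 s2 s3 = `|imbalance t1 t2 t3|].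
Proof.
refine (angle_solution_imbalance s1 s2 s3 _ _ _ _ (@imbalance_eq0 R t1 t2 t3)).
- exact: conc_sqr_le1.
- exact: co_conc.
- exact: co_conc.
- exact: co_conc.
Qed.

Lemma sign_choice_imbalance (R : realType) (t1 t2 t3 : R) :
  sign_choice t1 t2 t3 <->
  imbalance t1 (pi / 2) 0 <= 0 /\ 0 <= imbalance t1 t2 t3.
Proof.
rewrite /sign_choice imbalance1E /imbalance alpha1_sqr.
by split=> [] [h1 h2]; split; lra.
Qed.

(** At the state's own angles the formulas say m1 = -|m1|, m2 = |m2|, m3 = |m3|; the second follows
    from the third by m3 <= m2. *)
Lemma angle_solution_sign_choice (R : realType) (t1 t2 t3 : R) :
  angle_solution (conc1 t1) (conc2 t1 t2) (conc t1 t2 t3) t1 t2 t3 <->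
  sign_choice t1 t2 t3.
Proof.
have core (m1 m2 m3 : R) : m3 <= m2 ->
    [/\ m1 = - `|m1|, m2 = `|m2| & m3 = `|m3|] <-> m1 <= 0 /\ 0 <= m3.
  move=> m32; split=> [[e1 _ e3]|[h1 h3]].
    by split; [rewrite e1 oppr_le0 | rewrite e3].
  have h2 := le_trans h3 m32.
  by split; [rewrite ler0_norm // opprK | rewrite ger0_norm | rewrite ger0_norm].
apply: iff_trans (conc_angle_solution t1 t2 t3 t1 t2 t3) _.
apply: iff_trans (iff_sym (sign_choice_imbalance t1 t2 t3)).
exact: core (imbalance_le2 t1 t2 t3).
Qed.

(** * Amplitudes from the formulas, and existence of angles *)

Lemma sol_alpha_sqr (R : realType) (c1 c2 c t1 t2 t3 : R) :
  angle_solution c1 c2 c t1 t2 t3 ->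
  [/\ alpha1 t1 t2 t3 ^+ 2 = sol_sin2_1 c1,
      alpha2 t1 t2 t3 ^+ 2 = (1 - sol_sin2_1 c1) * (1 - sol_cos2_2 c1 c2),
      alpha3 t1 t2 t3 ^+ 2
        = (1 - sol_sin2_1 c1) * sol_cos2_2 c1 c2 * sol_cos2_3 c1 c2 c
    & alpha4 t1 t2 t3 ^+ 2
        = (1 - sol_sin2_1 c1) * sol_cos2_2 c1 c2 * (1 - sol_cos2_3 c1 c2 c)].
Proof.
move=> [e1 e2 e3]; rewrite !alpha_sqr e1 e2.
have [uv0|/e3 ->] := eqVneq (co c1 + co c2) 0; last by [].
(* The prescribed cos^2 t2 is 0, so the last two amplitudes vanish whatever [t3] is. *)
by rewrite /sol_cos2_2 uv0 mul0r !mulr0 !mul0r.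
Qed.

Lemma angle_solution_exists (R : realType) (c1 c2 c : R) :
  0 <= sol_sin2_1 c1 <= 1 -> 0 <= sol_cos2_2 c1 c2 <= 1 ->
  0 <= sol_cos2_3 c1 c2 c <= 1 ->
  exists s1 s2 s3 : R, angle_range s1 s2 s3 /\ angle_solution c1 c2 c s1 s2 s3.
Proof.
have sqrt_le1 (a : R) : 0 <= a <= 1 -> [&& Num.sqrt a ^+ 2 == a, 0 <= Num.sqrt a,
    -1 <= Num.sqrt a & Num.sqrt a <= 1].
  move=> /andP[a0 a1]; have s0 := sqrtr_ge0 a.
  rewrite sqr_sqrtr // eqxx s0 /= (le_trans _ s0) ?lerN10 //=.
  by rewrite -sqrtr1 ler_sqrt.
move=> /sqrt_le1/and4P[/eqP q1 p1 l1 r1] /sqrt_le1/and4P[/eqP q2 p2 l2 r2].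
move=> /sqrt_le1/and4P[/eqP q3 p3 l3 r3].
exists (asin (Num.sqrt (sol_sin2_1 c1))), (acos (Num.sqrt (sol_cos2_2 c1 c2))),
  (acos (Num.sqrt (sol_cos2_3 c1 c2 c))).
split; last first.
  by split=> [||_]; rewrite ?asinK ?acosK ?in_itv /= ?l1 ?l2 ?l3.
have pi0 := pi_ge0 R.
split; rewrite ?acos_ge0 ?acos_lepi ?l2 ?l3 //.
have := @asin_lepi2 R _ (introT andP (conj l1 r1)) => a1.
apply/andP; split; last lra.
(* A negative arcsine would lie in [-pi/2, 0) and have negative sine, but its sine is a square
   root. *)
rewrite leNgt; apply/negP => a0; move: p1.
have {1}<- : sin (asin (Num.sqrt (sol_sin2_1 c1))) = Num.sqrt (sol_sin2_1 c1).
  by rewrite asinK // in_itv /= l1.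
have := @asin_geNpi2 R _ (introT andP (conj l1 r1)) => a2.
rewrite leNgt -[X in sin X]opprK sinN oppr_lt0 sin_gt0_pi //.
apply/andP; split; lra.
Qed.

(** From [c2 <= c] comes w <= v, which is what bounds (u + w) / (u + v) by 1. *)
Lemma solution_range (R : realType) (c1 c2 c : R) :
  c1 ^+ 2 <= 1 -> 0 <= c2 -> c2 <= c ->
  [/\ 0 <= sol_sin2_1 c1 <= 1, 0 <= sol_cos2_2 c1 c2 <= 1
    & 0 <= sol_cos2_3 c1 c2 c <= 1].
Proof.
move=> c1_le1 c2_ge0 c2c.
have u2 := co_sqr c1_le1; have wv := co_le c2_ge0 c2c.
rewrite /sol_sin2_1 /sol_cos2_2 /sol_cos2_3.
have u0 := co_ge0 c1; have v0 := co_ge0 c2; have w0 := co_ge0 c.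
have u1 := co_le1 c1; have v1 := co_le1 c2.
move: (co c1) (co c2) (co c) u2 wv u0 v0 w0 u1 v1 => u v w u2 wv u0 v0 w0 u1 v1.
split; first by apply/andP; split; lra.
  by rewrite divr_ge0 ?addr_ge0 //= ler_pdivrMr ?mul1r; lra.
(* Division by zero yields 0, which lies in the required interval. *)
have [uv0|uv] := eqVneq (u + v) 0; first by rewrite uv0 invr0 !mulr0 lexx ler01.
have uv_gt0 : 0 < u + v by rewrite lt_def uv addr_ge0.
have -> : u * v + 1 - c1 ^+ 2 = u * (u + v) by rewrite -addrA -u2; ring.
have -> : (u * (u + v) / (u + v) + w) / (u + v) = (u + w) / (u + v) by field.
by rewrite divr_ge0 ?addr_ge0 //= ler_pdivrMr // mul1r lerD2l.
Qed.

(** * Classification of states by their concurrences *)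

Lemma angle_solution_alpha_sqr (R : realType) (c1 c2 c t1 t2 t3 s1 s2 s3 : R) :
  angle_solution c1 c2 c t1 t2 t3 -> angle_solution c1 c2 c s1 s2 s3 ->
  [/\ alpha1 s1 s2 s3 ^+ 2 = alpha1 t1 t2 t3 ^+ 2,
      alpha2 s1 s2 s3 ^+ 2 = alpha2 t1 t2 t3 ^+ 2,
      alpha3 s1 s2 s3 ^+ 2 = alpha3 t1 t2 t3 ^+ 2
    & alpha4 s1 s2 s3 ^+ 2 = alpha4 t1 t2 t3 ^+ 2].
Proof.
move=> /sol_alpha_sqr[h1 h2 h3 h4] /sol_alpha_sqr[k1 k2 k3 k4].
split; [exact: etrans k1 (esym h1) | exact: etrans k2 (esym h2)
       | exact: etrans k3 (esym h3) | exact: etrans k4 (esym h4)].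
Qed.

(** Under the sign choice both states obey the formulas at the same concurrence values, and these
    fix the squared amplitudes. *)
Lemma sign_choice_classifies (R : realType) (t1 t2 t3 s1 s2 s3 : R) :
  sign_choice t1 t2 t3 -> sign_choice s1 s2 s3 ->
  conc1 s1 = conc1 t1 -> conc2 s1 s2 = conc2 t1 t2 ->
  conc s1 s2 s3 = conc t1 t2 t3 ->
  [/\ alpha1 s1 s2 s3 ^+ 2 = alpha1 t1 t2 t3 ^+ 2,
      alpha2 s1 s2 s3 ^+ 2 = alpha2 t1 t2 t3 ^+ 2,
      alpha3 s1 s2 s3 ^+ 2 = alpha3 t1 t2 t3 ^+ 2
    & alpha4 s1 s2 s3 ^+ 2 = alpha4 t1 t2 t3 ^+ 2].
Proof.
have transport (c1 c2 c c1' c2' c' : R) :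
    angle_solution c1' c2' c' s1 s2 s3 -> c1' = c1 -> c2' = c2 -> c' = c ->
    angle_solution c1 c2 c s1 s2 s3.
  by move=> h <- <- <-.
move=> /angle_solution_sign_choice ht /angle_solution_sign_choice hs e1 e2 e3.
exact: angle_solution_alpha_sqr ht (transport _ _ _ _ _ _ hs e1 e2 e3).
Qed.

(** Normalization recovers the fourth squared amplitude from the other three. *)
Lemma conc_determined (R : realType) (t1 t2 t3 s1 s2 s3 : R) :
  alpha1 s1 s2 s3 ^+ 2 = alpha1 t1 t2 t3 ^+ 2 ->
  alpha2 s1 s2 s3 ^+ 2 = alpha2 t1 t2 t3 ^+ 2 ->
  alpha3 s1 s2 s3 ^+ 2 = alpha3 t1 t2 t3 ^+ 2 ->
  conc s1 s2 s3 = conc t1 t2 t3.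
Proof.
move=> e1 e2 e3; apply: eq_conc.
have := alpha_norm t1 t2 t3; have := alpha_norm s1 s2 s3.
by move=> ? ?; congr `|_|; rewrite /imbalance; lra.
Qed.

Lemma conc1_determined (R : realType) (t1 s1 : R) :
  sin s1 ^+ 2 = sin t1 ^+ 2 -> conc1 s1 = conc1 t1.
Proof. by move=> e; apply: eq_conc; congr `|_|; rewrite 2!imbalance1E; lra. Qed.

(** At [t3 = 0] the eigenvalue q is gamma2^2, so m2 = 1 - 2 gamma2^2. *)
Lemma conc2_determined (R : realType) (t1 t2 s1 s2 : R) :
  (cos s1 * sin s2) ^+ 2 = (cos t1 * sin t2) ^+ 2 -> conc2 s1 s2 = conc2 t1 t2.
Proof.
move=> e; apply: eq_conc; congr `|_|.
rewrite 2!imbalance2E -!mulrA -(alpha2_sqr s1 s2 0) -(alpha2_sqr t1 t2 0).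
by rewrite /alpha2; lra.
Qed.

Theorem mainTheorem3 (R : realType) (t1 t2 t3 : R)
    (ht : angle_range t1 t2 t3) :
  let c1 := conc1 t1 in
  let c2 := conc2 t1 t2 in
  let c := conc t1 t2 t3 in
  (* the coefficients are normalized *)
  alpha1 t1 t2 t3 ^+ 2 + alpha2 t1 t2 t3 ^+ 2
    + alpha3 t1 t2 t3 ^+ 2 + alpha4 t1 t2 t3 ^+ 2 = 1 /\
  (* the angles of psi are given by the formulas exactly for the stated choice
     of signs, and then the squared coefficients are functions of c1, c2, c *)
  (angle_solution c1 c2 c t1 t2 t3 <-> sign_choice t1 t2 t3) /\
  (sign_choice t1 t2 t3 ->
    [/\ alpha1 t1 t2 t3 ^+ 2 = sol_sin2_1 c1,
        alpha2 t1 t2 t3 ^+ 2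
          = (1 - sol_sin2_1 c1) * (1 - sol_cos2_2 c1 c2),
        alpha3 t1 t2 t3 ^+ 2
          = (1 - sol_sin2_1 c1) * sol_cos2_2 c1 c2 * sol_cos2_3 c1 c2 c
      & alpha4 t1 t2 t3 ^+ 2
          = (1 - sol_sin2_1 c1) * sol_cos2_2 c1 c2
            * (1 - sol_cos2_3 c1 c2 c)]) /\
  (* angles satisfying the formulas solve the equations given by the three
     concurrences, and such angles exist iff c2 <= c *)
  (forall s1 s2 s3 : R, angle_solution c1 c2 c s1 s2 s3 ->
    [/\ conc1 s1 = c1, conc2 s1 s2 = c2 & conc s1 s2 s3 = c]) /\
  ((exists s1 s2 s3 : R,
      angle_range s1 s2 s3 /\ angle_solution c1 c2 c s1 s2 s3) <-> c2 <= c) /\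
  (* c1^2 is determined by beta1^2, c2^2 by gamma1^2 and gamma2^2, and c^2 by
     alpha1^2, alpha2^2 and alpha3^2 *)
  (forall s1 s2 s3 : R,
    [/\ sin s1 ^+ 2 = sin t1 ^+ 2 -> conc1 s1 ^+ 2 = c1 ^+ 2,
        sin s1 ^+ 2 = sin t1 ^+ 2 ->
          (cos s1 * sin s2) ^+ 2 = (cos t1 * sin t2) ^+ 2 ->
          conc2 s1 s2 ^+ 2 = c2 ^+ 2
      & alpha1 s1 s2 s3 ^+ 2 = alpha1 t1 t2 t3 ^+ 2 ->
          alpha2 s1 s2 s3 ^+ 2 = alpha2 t1 t2 t3 ^+ 2 ->
          alpha3 s1 s2 s3 ^+ 2 = alpha3 t1 t2 t3 ^+ 2 ->
          conc s1 s2 s3 ^+ 2 = c ^+ 2]) /\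
  (* the squared concurrences classify the states with that choice of signs *)
  (sign_choice t1 t2 t3 ->
    forall s1 s2 s3 : R, sign_choice s1 s2 s3 ->
    [/\ conc1 s1 ^+ 2 = c1 ^+ 2, conc2 s1 s2 ^+ 2 = c2 ^+ 2
      & conc s1 s2 s3 ^+ 2 = c ^+ 2] <->
    [/\ alpha1 s1 s2 s3 ^+ 2 = alpha1 t1 t2 t3 ^+ 2,
        alpha2 s1 s2 s3 ^+ 2 = alpha2 t1 t2 t3 ^+ 2,
        alpha3 s1 s2 s3 ^+ 2 = alpha3 t1 t2 t3 ^+ 2
      & alpha4 s1 s2 s3 ^+ 2 = alpha4 t1 t2 t3 ^+ 2]).
Proof.
have sqr_eq (a b : R) : a = b -> a ^+ 2 = b ^+ 2 by move=> ->.
have eq_sqr (a b : R) : 0 <= a -> 0 <= b -> a ^+ 2 = b ^+ 2 -> a = b.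
  by move=> a0 b0 /eqP; rewrite eqrXn2 // => /eqP.
move=> c1 c2 c; split; first exact: alpha_norm.
split; first exact: angle_solution_sign_choice.
split.
  by move=> h; apply: sol_alpha_sqr; exact/angle_solution_sign_choice.
split.
  move=> s1 s2 s3 /(conc_angle_solution t1 t2 t3)[e1 e2 e3].
  have norm_eq (m a : R) : m = `|a| -> `|m| = `|a| by move=> ->; rewrite normr_id.
  have normN_eq (m a : R) : m = - `|a| -> `|m| = `|a|.
    by move=> ->; rewrite normrN normr_id.
  split; first exact: eq_conc (normN_eq _ _ e1).
    exact: eq_conc (norm_eq _ _ e2).
  exact: eq_conc (norm_eq _ _ e3).
split.
  split.
    (* For a solution, m3 <= m2 at the angles [s1], [s2], [s3] becomes |m3| <= |m2| at the original
       ones, and concurrence decreases in |m|. *)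
    move=> [s1 [s2 [s3 [_ /(conc_angle_solution t1 t2 t3)[_ e2 e3]]]]].
    have le_of_eq (m2 m3 a b : R) : m2 = a -> m3 = b -> m3 <= m2 -> b <= a.
      by move=> <- <-.
    exact: conc_le (le_of_eq _ _ _ _ e2 e3 (imbalance_le2 s1 s2 s3)).
  move=> c2c.
  have [] := solution_range (conc_sqr_le1 t1 (pi / 2) 0) (conc_ge0 t1 t2 0) c2c.
  exact: angle_solution_exists.
split.
  move=> s1 s2 s3; split.
  - by move=> h; exact: sqr_eq (conc1_determined h).
  - by move=> _ h; exact: sqr_eq (conc2_determined h).
  - by move=> h1 h2 h3; exact: sqr_eq (conc_determined h1 h2 h3).
move=> ht_sign s1 s2 s3 hs_sign; split=> [[e1 e2 e3]|[e1 e2 e3 _]].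
  (* Concurrences are nonnegative, so equal squares give equal values. *)
  refine (sign_choice_classifies ht_sign hs_sign _ _ _).
  - exact: eq_sqr (conc_ge0 _ _ _) (conc_ge0 _ _ _) e1.
  - exact: eq_sqr (conc_ge0 _ _ _) (conc_ge0 _ _ _) e2.
  - exact: eq_sqr (conc_ge0 _ _ _) (conc_ge0 _ _ _) e3.
split; [exact: sqr_eq (conc1_determined e1) | exact: sqr_eq (conc2_determined e2)
       | exact: sqr_eq (conc_determined e1 e2 e3)].
Qed.
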